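(* Let $(\mu,\nu)\in\mathcal{M}_{\mathbb{T}}\times\mathcal{M}_{\mathbb{T}}$ be a $\boxtimes$-infinitely divisible pair with $\int_{\mathbb{T}}\zeta\,d\mu(\zeta)=0$. Then $\mu=m$, the Haar (normalized arc-length) measure on $\mathbb{T}$.
   Context: $\mathbb{T}$ is the unit circle and $\mathcal{M}_{\mathbb{T}}$ is the set of Borel probability measures on $\mathbb{T}$. c-freeness: let $\mathcal{A}$ be a unital algebra with normalized linear functionals $\varphi,\psi$ ($\varphi(1)=\psi(1)=1$). Elements $X,Y\in\mathcal{A}$ are c-free if the unital subalgebras $\mathcal{A}_1,\mathcal{A}_2$ they generate satisfy: whenever $a_j\in\mathcal{A}_{\varepsilon(j)}$, $\varepsilon(j)\in\{1,2\}$, $\varepsilon(1)\ne\varepsilon(2)\ne\dots\ne\varepsilon(n)$ (consecutive indices differ) and $\psi(a_j)=0$ for all $j$, one has $\psi(a_1\cdots a_n)=0$ and $\varphi(a_1\cdots a_n)=\varphi(a_1)\cdots\varphi(a_n)$. An element $X$ has distribution $(\mu,\nu)$ if $\varphi(X^n)=\int\zeta^n d\mu(\zeta)$ and $\psi(X^n)=\int\zeta^nd\nu(\zeta)$ for all $n\ge1$. The multiplicative c-free convolution $(\mu_1,\nu_1)\boxtimes(\mu_2,\nu_2)\in\mathcal{M}_{\mathbb{T}}\times\mathcal{M}_{\mathbb{T}}$ is the distribution of $XY$, where $X,Y$ are c-free with distributions $(\mu_1,\nu_1)$ and $(\mu_2,\nu_2)$. When $\int\zeta\,d\nu_1\neq0\neq\int\zeta\,d\nu_2$,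 this is the unique pair $(\mu,\nu)$ with $T_\nu=T_{\nu_1}T_{\nu_2}$ and ${}^cT_{(\mu,\nu)}={}^cT_{(\mu_1,\nu_1)}{}^cT_{(\mu_2,\nu_2)}$ near $0$, where $m_\mu(z)=\int_{\mathbb{T}}\frac{z\zeta}{1-z\zeta}d\mu(\zeta)$, $R_\nu(z[1+m_\nu(z)])=m_\nu(z)$, ${}^cR_{(\mu,\nu)}(z[1+m_\nu(z)])(1+m_\mu(z))=m_\mu(z)(1+m_\nu(z))$, $T_\nu(z)=\left(\frac1zR_\nu\right)\circ R_\nu^{\langle-1\rangle}(z)$ and ${}^cT_{(\mu,\nu)}(z)=\left(\frac1z{}^cR_{(\mu,\nu)}\right)\circ R_\nu^{\langle-1\rangle}(z)$ ($F^{\langle-1\rangle}$ is the inverse under composition, and $\left(\frac1zF\right)\circ G$ is $F(z)/z$ composed with $G$). A pair $(\mu,\nu)\in\mathcal{M}_{\mathbb{T}}\times\mathcal{M}_{\mathbb{T}}$ is $\boxtimes$-infinitely divisible if for every $n\in\mathbb{N}$ there is $(\mu_n,\nu_n)\in\mathcal{M}_{\mathbb{T}}\times\mathcal{M}_{\mathbb{T}}$ with $(\mu,\nu)=(\mu_n,\nu_n)\boxtimes\cdots\boxtimes(\mu_n,\nu_n)$ ($n$ times). *)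

(* Defs.v *)
From HB Require Import structures.
From mathcomp Require Import all_boot all_order all_algebra.
From mathcomp Require Import all_classical all_reals all_analysis.
From mathcomp Require Import complex.
Set Implicit Arguments.
Unset Strict Implicit.
Unset Printing Implicit Defensive.
Import Order.TTheory GRing.Theory Num.Theory.
Import numFieldNormedType.Exports.
Local Open Scope classical_set_scope.
Local Open Scope ring_scope.
Local Open Scope complex_scope.

Definition circle (R : realType) : Type := set_type [set z : R[i]^o | `|z| = 1].

HB.instance Definition _ (R : realType) :=
  Topological.copy (circle R) (set_type [set z : R[i]^o | `|z| = 1]).

Section Circle.
Context {R : realType}.

Definition circle_val (z : circle R) : R[i] := \val z.

Lemma circle1_subproof : (1 : R[i]^o) \in [set z : R[i]^o | `|z| = 1].
Proof. by apply/mem_set; rewrite /= normr1. Qed.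

Definition circle1 : circle R := exist _ 1 circle1_subproof.

Lemma expi_subproof (t : R) :
  (cos t +i* sin t : R[i]^o) \in [set z : R[i]^o | `|z| = 1].
Proof. by apply/mem_set; rewrite /= normc_def cos2Dsin2 sqrtr1. Qed.

Definition expi : measurableTypeR R -> circle R :=
  fun t => exist _ (cos t +i* sin t) (expi_subproof t).

Lemma normc_le (x y : R) : `|x +i* y| <= (`|x| + `|y|)%:C :> R[i].
Proof.
have -> : x +i* y = x%:C + y *i by apply/eqP; rewrite eq_complex /= addr0 add0r !eqxx.
apply: (le_trans (ler_normD _ _)).
by rewrite !normc_def /= !expr0n /= addr0 add0r !sqrtr_sqr -rmorphD lexx.
Qed.

Lemma continuous_cis : continuous (fun t : R => (cos t +i* sin t : R[i]^o)).
Proof.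
move=> t; apply/cvgrPdist_lt => /= e e0.
have [e1 e2] : 0 < complex.Re e /\ e = (complex.Re e)%:C.
  by case: e e0 => a b; rewrite ltcE /= => /andP[/eqP -> ->].
have h0 : 0 < complex.Re e / 2 by rewrite divr_gt0.
have /cvgrPdist_lt/(_ _ h0) hc := @continuous_cos R t.
have /cvgrPdist_lt/(_ _ h0) hs := @continuous_sin R t.
near=> s.
have -> : (cos t +i* sin t) - (cos s +i* sin s)
   = (cos t - cos s) +i* (sin t - sin s) :> R[i] by [].
apply: (le_lt_trans (normc_le _ _)).
rewrite e2 ltcR [ltRHS]splitr ltrD//.
- by near: s; exact: hc.
- by near: s; exact: hs.
Unshelve. all: by end_near. Qed.

Lemma continuous_expi : continuous (expi : R -> circle R).
Proof. by apply: continuous_comp_initial; exact: continuous_cis. Qed.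

End Circle.

HB.instance Definition _ (R : realType) := isPointed.Build (circle R) circle1.

HB.instance Definition _ (R : realType) :=
  @isMeasurable.Build (sigma_display (@open (circle R))) (circle R)
    <<s @open (circle R) >> (@sigma_algebra0 _ setT _) (@sigma_algebraC _ _)
    (@sigma_algebra_bigcup _ setT _).

Section Haar.
Context (R : realType).

Lemma measurable_expi : measurable_fun [set: measurableTypeR R] (@expi R).
Proof.
apply: (@measurability _ _ _ (circle R) _ _ (@open (circle R))) => //.
move=> _ [A oA <-]; rewrite setTI; apply: measurable_realfun.open_measurable.
by move/continuousP: (@continuous_expi R); exact.
Qed.

HB.instance Definition _ := @isMeasurableFun.Build _ _ (measurableTypeR R)
  (circle R) (@expi R) measurable_expi.

Lemma two_pi_gt0 : 0 < 2 * pi :> R.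
Proof. by rewrite mulr_gt0 ?pi_gt0. Qed.

(* image of the uniform law on [0, 2 pi] under t |-> exp(i t) *)
Definition haar : probability (circle R) R :=
  distribution (uniform_prob two_pi_gt0)
    (@expi R : {mfun measurableTypeR R >-> circle R}).

End Haar.

(* the library's integral is real-valued, so integrate the real and imaginary
   parts of z ^+ n *)
Definition moment (R : realType) (mu : probability (circle R) R) (n : nat) : R[i] :=
  (\int[mu]_z complex.Re (circle_val z ^+ n)) +i*
  (\int[mu]_z complex.Im (circle_val z ^+ n)).

Section CFree.
Context {R : realType} {A : algType R[i]}.
Implicit Types (phi psi : {scalar A}) (X Y : A).

Definition gen_subalg X : set A :=
  [set a | forall S : {pred A}, GRing.subalg_closed S -> X \in S -> a \in S].

(* [eps j] tells from which of the two subalgebras [a j] is taken *)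
Definition cfree phi psi X Y : Prop :=
  forall (n : nat) (eps : 'I_n.+1 -> bool) (a : 'I_n.+1 -> A),
    (forall j, gen_subalg (if eps j then X else Y) (a j)) ->
    (forall j k : 'I_n.+1, k = j.+1 :> nat -> eps j != eps k) ->
    (forall j, psi (a j) = 0) ->
    psi (\prod_j a j) = 0 /\ phi (\prod_j a j) = \prod_j phi (a j).

Definition has_distribution phi psi X
    (p : probability (circle R) R * probability (circle R) R) : Prop :=
  forall n : nat, (0 < n)%N ->
    phi (X ^+ n) = moment p.1 n /\ psi (X ^+ n) = moment p.2 n.

End CFree.

Section Convolution.
Context {R : realType}.
Local Notation pair := (probability (circle R) R * probability (circle R) R)%type.
Implicit Types p q r : pair.

(* p is the convolution of p1 and p2; a relation, since a measure is determined
   by its moments only up to its values on nonmeasurable sets *)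
Definition is_cfree_mconv (p1 p2 p : pair) : Prop :=
  exists (A : algType R[i]) (phi psi : {scalar A}) (X Y : A),
    [/\ phi 1 = 1 /\ psi 1 = 1,
        cfree phi psi X Y,
        has_distribution phi psi X p1,
        has_distribution phi psi Y p2
      & has_distribution phi psi (X * Y) p].

Inductive is_cfree_mpow q : nat -> pair -> Prop :=
| cfree_mpow1 : is_cfree_mpow q 1 q
| cfree_mpowS n r p : is_cfree_mpow q n r -> is_cfree_mconv r q p ->
    is_cfree_mpow q n.+1 p.

Definition cfree_minfdiv p : Prop :=
  forall n : nat, (0 < n)%N -> exists q, is_cfree_mpow q n p.

End Convolution.

(* Main.v *)
(* The first moment is multiplicative under c-free convolution, so every
   convolution root q of (mu, nu) also has phi-mean 0.  The key point is that if X, Y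
   are c-free, phi(X^j) = 0 for 1 <= j <= k and phi(Y) = 0, then phi((XY)^j) = 0 for
   1 <= j <= k + 1; hence the n-th power of q has vanishing phi-moments 1, ..., n, and
   letting n grow all moments of mu vanish.
   For the key point, expand in alternating words in the centered powers
   X^i - psi(X^i) and Y^i - psi(Y^i), graded by the degree in X.  On these words phi is
   multiplicative, so phi(uY) = phi(u) phi(Y) = 0 when u is spanned by words ending in
   X, and phi(X w) = 0 when w is spanned by words of X-degree < k.  Finally
   (XY)^(j+1) = X v Y with v = (YX)^j a sum of elements of these two kinds.
   A probability on the circle is determined by its moments: they fix the integrals of
   trigonometric polynomials, and indicators of the sets {a < Re z < b, c < Im z < d}
   are bounded pointwise limits of such polynomials. *)
Require Import Defs.
From mathcomp Require Import all_boot all_order all_algebra.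
From mathcomp Require Import all_classical all_reals all_analysis.
From mathcomp Require Import complex ring lra zify.
Import Order.TTheory GRing.Theory Num.Theory.
Import numFieldNormedType.Exports.
Local Open Scope classical_set_scope.
Local Open Scope ring_scope.

(** * Alternating words in centered powers of two c-free elements *)

Section CenteredWords.
Context {R : realType} {A : algType R[i]}.
Variables (phi psi : {scalar A}) (X Y : A).
Hypotheses (phi1 : phi 1 = 1) (psi1 : psi 1 = 1) (cfXY : cfree phi psi X Y).

Definition letter (b : bool) : A := if b then X else Y.

(** Subtracting the [psi]-mean puts the power in the kernel of [psi], as c-freeness requires.
    Exponent 0 is allowed and gives 0, since [psi 1 = 1]. *)
Definition syllable (s : bool * nat) : A :=
  letter s.1 ^+ s.2 - (psi (letter s.1 ^+ s.2))%:A.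

Definition eval_word (w : seq (bool * nat)) : A := \prod_(s <- w) syllable s.

Definition alternating (w : seq (bool * nat)) : bool :=
  sorted (fun s t => s.1 != t.1) w.

Definition degX (w : seq (bool * nat)) : nat := \sum_(s <- w) s.1 * s.2.

Lemma psi_syllable s : psi (syllable s) = 0.
Proof. by rewrite /syllable linearB linearZ /= psi1 mulr1 subrr. Qed.

Lemma phi_syllable s :
  phi (syllable s) = phi (letter s.1 ^+ s.2) - psi (letter s.1 ^+ s.2).
Proof. by rewrite /syllable linearB linearZ /= phi1 mulr1. Qed.

Lemma gen_subalg_syllable s : gen_subalg (if s.1 then X else Y) (syllable s).
Proof.
rewrite /gen_subalg /= => S [S1 Slin SM] Sg.
have SX n : letter s.1 ^+ n \in S.
  by elim: n => [|n IH]; rewrite ?expr0 // exprS SM.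
rewrite /syllable addrC -scaleNr.
by apply: Slin => //; exact: SX.
Qed.

Lemma phi_eval_word w : alternating w ->
  phi (eval_word w) = \prod_(s <- w) phi (syllable s).
Proof.
(* [cfree] speaks of nonempty products only; the empty word is covered by [phi 1 = 1]. *)
case: w => [|s0 w] altw; first by rewrite /eval_word !big_nil.
have [|||_] := cfXY (size w) (fun j => (nth s0 (s0 :: w) j).1)
  (fun j => syllable (nth s0 (s0 :: w) j)).
- by move=> j; exact: gen_subalg_syllable.
- move=> j k kj; move: altw => /(sortedP s0) /(_ j); rewrite -kj; apply.
  by rewrite /= ltn_ord.
- by move=> j; exact: psi_syllable.
rewrite /eval_word !(big_nth s0) !big_mkord /= => ->.
by [].
Qed.

(** The linear span of the words satisfying [P], built term by term so that linear claims reduce by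
    induction to a single word. *)
Inductive wspan (P : seq (bool * nat) -> Prop) : A -> Prop :=
| wspan0 : wspan P 0
| wspan_cons c w a : P w -> wspan P a -> wspan P (c *: eval_word w + a).

Lemma wspanD P a b : wspan P a -> wspan P b -> wspan P (a + b).
Proof.
elim=> [|c w a' Pw _ IH] Pb; first by rewrite add0r.
by rewrite -addrA; apply: wspan_cons => //; exact: IH.
Qed.

Lemma wspanZ P c a : wspan P a -> wspan P (c *: a).
Proof.
elim=> [|d w a' Pw _ IH]; first by rewrite scaler0; exact: wspan0.
by rewrite scalerDr scalerA; exact: wspan_cons.
Qed.

Lemma wspan_word P w : P w -> wspan P (eval_word w).
Proof.
by move=> Pw; rewrite -[eval_word w]addr0 -[eval_word w]scale1r;
  apply: wspan_cons => //; exact: wspan0.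
Qed.

Lemma wspan_sub (P Q : seq (bool * nat) -> Prop) a :
  (forall w, P w -> Q w) -> wspan P a -> wspan Q a.
Proof.
move=> PQ; elim=> [|c w a' Pw _ IH]; first exact: wspan0.
by apply: wspan_cons => //; exact: PQ.
Qed.

Lemma wspan_linear P Q (f : {linear A -> A}) a :
  (forall w, P w -> wspan Q (f (eval_word w))) -> wspan P a -> wspan Q (f a).
Proof.
move=> PQ; elim=> [|c w a' Pw _ IH]; first by rewrite linear0; exact: wspan0.
by rewrite linearP; apply: wspanD => //; apply: wspanZ; exact: PQ.
Qed.


(** With x the letter, the product is [x^(n+1) - psi(x^n) x]; re-centering both powers leaves a
    multiple of 1. *)
Lemma syllableMr b n : syllable (b, n) * letter b =
  syllable (b, n.+1) - psi (letter b ^+ n) *: syllable (b, 1%N)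
  + (psi (letter b ^+ n.+1) - psi (letter b ^+ n) * psi (letter b)) *: 1.
Proof.
rewrite /syllable /= expr1 mulrBl -exprSr mulr_algl scalerBr scalerBl scalerA.
by rewrite opprB -[RHS]addrA [X in _ = _ + X]addrC !subrKA.
Qed.

Lemma syllableMl b n : letter b * syllable (b, n) =
  syllable (b, n.+1) - psi (letter b ^+ n) *: syllable (b, 1%N)
  + (psi (letter b ^+ n.+1) - psi (letter b ^+ n) * psi (letter b)) *: 1.
Proof.
rewrite -syllableMr /syllable /= mulrBr mulrBl -exprS -exprSr.
by rewrite mulr_algl mulr_algr.
Qed.

Lemma letterE b : letter b = syllable (b, 1%N) + psi (letter b) *: 1.
Proof. by rewrite /syllable expr1 subrK. Qed.

Lemma eval_word_nil : eval_word [::] = 1.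
Proof. by rewrite /eval_word big_nil. Qed.

Lemma eval_word_cons s w : eval_word (s :: w) = syllable s * eval_word w.
Proof. by rewrite /eval_word big_cons. Qed.

Lemma eval_word_rcons w s : eval_word (rcons w s) = eval_word w * syllable s.
Proof. by rewrite /eval_word big_rcons. Qed.

Lemma degX_rcons w s : degX (rcons w s) = (degX w + s.1 * s.2)%N.
Proof. by rewrite /degX big_rcons. Qed.

Lemma degX_cons w s : degX (s :: w) = (s.1 * s.2 + degX w)%N.
Proof. by rewrite /degX big_cons. Qed.

Lemma alternating_rcons w s t :
  alternating (rcons (rcons w s) t) = alternating (rcons w s) && (s.1 != t.1).
Proof. by case: w => [|u w]; rewrite /alternating /= ?andbT// rcons_path last_rcons. Qed.

Lemma alternating_rcons_exp w b m n :
  alternating (rcons w (b, m)) = alternating (rcons w (b, n)).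
Proof. by case: w => [|s w]; rewrite /alternating//= !rcons_path. Qed.

Lemma alternating_cons_exp w b m n :
  alternating ((b, m) :: w) = alternating ((b, n) :: w).
Proof. by case: w. Qed.

Lemma alternating_belast w s : alternating (rcons w s) -> alternating w.
Proof. by case: w => [|u w] //; rewrite /alternating /= rcons_path => /andP[]. Qed.

(** If [w] ends in the letter [b], re-centering raises the last exponent by one, resets it to 1 or
    drops the last syllable. Otherwise a new syllable is appended, or the letter is replaced by its
    [psi]-mean. Only terms ending in [b] can gain degree. *)
Lemma eval_wordMr b w : alternating w ->
  wspan (fun v => alternating v /\ ((degX v <= degX w)%N \/
    (exists u n, v = rcons u (b, n)) /\ (degX v <= degX w + b)%N))
    (eval_word w * letter b).
Proof.
case: (lastP w) => [_|u [c n]].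
  rewrite eval_word_nil mul1r letterE; apply: wspanD; last apply: wspanZ.
    rewrite -[syllable _]mul1r -eval_word_nil -eval_word_rcons.
    apply: wspan_word; split => //; right; split; first by exists [::], 1%N.
    by rewrite /= degX_cons /degX !big_nil /= muln1 addn0.
  by rewrite -eval_word_nil; apply: wspan_word; split => //; left.
case: (eqVneq c b) => [-> altw|cb altw].
  rewrite eval_word_rcons -mulrA syllableMr mulrDr mulrBr -!scalerAr mulr1.
  rewrite -scaleNr -!eval_word_rcons.
  apply: wspanD; first apply: wspanD; last 2 first.
  - apply: wspanZ; apply: wspan_word; split.
      by rewrite (alternating_rcons_exp _ _ _ n).
    right; split; first by exists u, 1%N.
    by rewrite !degX_rcons /= muln1; lia.
  - apply: wspanZ; apply: wspan_word; split; first exact: alternating_belast altw.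
    by left; rewrite degX_rcons; lia.
  - apply: wspan_word; split; first by rewrite (alternating_rcons_exp _ _ _ n).
    right; split; first by exists u, n.+1.
    by rewrite !degX_rcons /=; nia.
rewrite letterE mulrDr -scalerAr mulr1 -eval_word_rcons; apply: wspanD.
  apply: wspan_word; split; first by rewrite alternating_rcons altw.
  right; split; first by exists (rcons u (c, n)), 1%N.
  by rewrite !degX_rcons /= muln1.
by apply: wspanZ; apply: wspan_word; split => //; left.
Qed.

(* Encodes: [w] is alternating, and empty or ending with a syllable in [X]. *)
Definition ends_in_X w := alternating (rcons w (false, 0%N)).

(** Left multiplication changes, drops or adds a first syllable in [X]. Dropping the only syllable
    leaves the empty word, which [ends_in_X] therefore admits. *)
Lemma ends_in_X_mulXl a : wspan ends_in_X a -> wspan ends_in_X (X * a).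
Proof.
apply: (wspan_linear _ _ (X \*o idfun)) => w /=.
have XE : X = letter true by [].
have X1 : wspan ends_in_X 1.
  by rewrite -eval_word_nil; apply: wspan_word.
have Xs n : wspan ends_in_X (syllable (true, n)).
  by rewrite -[syllable _]mulr1 -eval_word_nil -eval_word_cons; apply: wspan_word.
case: w => [_|[[] n] w Ew]; rewrite XE.
- rewrite eval_word_nil mulr1 letterE; apply: wspanD => //; exact: wspanZ.
- rewrite eval_word_cons mulrA syllableMl 2!mulrDl mulNr -!scalerAl mul1r.
  rewrite -scaleNr -!eval_word_cons.
  apply: wspanD; first apply: wspanD; last 2 first.
  - apply/wspanZ/wspan_word; move: Ew.
    by rewrite /ends_in_X !rcons_cons (alternating_cons_exp _ _ _ n).
  - apply/wspanZ/wspan_word; move: Ew; rewrite /ends_in_X/alternating /=.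
    exact: path_sorted.
  - apply/wspan_word; move: Ew.
    by rewrite /ends_in_X !rcons_cons (alternating_cons_exp _ _ _ n).
- rewrite letterE mulrDl -scalerAl mul1r -eval_word_cons.
  by apply: wspanD; last apply: wspanZ; apply: wspan_word.
Qed.

(** Write [Y] as its centered part plus [psi Y]. The centered part extends an alternating word and
    contributes the factor [phi Y - psi Y]; the constant contributes [psi Y]. *)
Lemma phi_mulYr a : wspan ends_in_X a -> phi (a * Y) = phi a * phi Y.
Proof.
elim=> [|c w b Ew _ IH]; first by rewrite mul0r !linear0 mul0r.
rewrite mulrDl -scalerAl !linearP IH mulrDl; congr (_ + _).
rewrite -mulrA; congr (_ * _).
have -> : Y = letter false by [].
have /alternating_belast altw := Ew.
rewrite [in LHS]letterE mulrDr -scalerAr mulr1 -eval_word_rcons linearD linearZ /=.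
rewrite !phi_eval_word // ?(alternating_rcons_exp _ _ _ 0)//.
rewrite big_rcons /= phi_syllable /= expr1; ring.
Qed.

(** An initial syllable of [w] in [X] is absorbed into [X ^+ i], which gives powers of [X] of
    exponent at most [k] times a word not beginning with [X]. On such products [phi] factors through
    a vanishing moment of [X]. *)
Lemma phi_mulXl (k i d : nat) a :
  (forall j, (0 < j <= k)%N -> phi (X ^+ j) = 0) ->
  (0 < i)%N -> (i + d <= k)%N ->
  wspan (fun w => alternating w /\ (degX w <= d)%N) a -> phi (X ^+ i * a) = 0.
Proof.
move=> momX i0 idk.
suff phiw w : alternating w -> (degX w <= d)%N -> phi (X ^+ i * eval_word w) = 0.
  elim=> [|c w b [altw degw] _ IH]; first by rewrite mulr0 linear0.
  by rewrite mulrDr -scalerAr linearP IH phiw // mulr0 addr0.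
(* The dummy syllable [(true, 0)] encodes that [u] is alternating and does not begin with [X]. *)
have notX n u : (0 < n <= k)%N -> alternating ((true, 0%N) :: u) ->
    phi (X ^+ n * eval_word u) = 0.
  move=> nk; rewrite (alternating_cons_exp _ _ _ n) => altu.
  have -> : X ^+ n = syllable (true, n) + psi (X ^+ n) *: 1.
    by rewrite /syllable subrK.
  rewrite mulrDl -scalerAl mul1r -eval_word_cons linearD linearZ /=.
  rewrite !phi_eval_word //; last exact: path_sorted altu.
  by rewrite big_cons phi_syllable /= momX // sub0r; ring.
case: w => [_ _|[[] n] w altw degw].
- by rewrite eval_word_nil mulr1 momX // i0; lia.
- rewrite eval_word_cons mulrA /syllable mulrBr -exprD mulr_algr mulrBl -scalerAl.
  rewrite degX_cons /= mul1n in degw.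
  rewrite (alternating_cons_exp _ _ _ 0) in altw.
  rewrite linearB linearZ /= !notX ?mulr0 ?subr0 //; lia.
- by apply: notX => //; lia.
Qed.

Lemma phi_mulXY_moments (k n : nat) :
  (forall j, (0 < j <= k)%N -> phi (X ^+ j) = 0) -> phi Y = 0 ->
  (0 < n <= k.+1)%N -> phi ((X * Y) ^+ n) = 0.
Proof.
move=> momX phiY /andP[].
(* Filtration by degree in [X]: right multiplication by [X] raises the level by one, by [Y] not at
   all. *)
pose M d := wspan (fun w => alternating w /\ (degX w <= d)%N).
have X1 : wspan ends_in_X 1.
  by rewrite -eval_word_nil; apply: wspan_word.
case: n => // [[_ _|n _ nk]].
  by rewrite expr1 phi_mulYr ?phiY ?mulr0// -[X]mulr1; exact: ends_in_X_mulXl.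
have MX d a : M d a -> M d.+1 (a * X).
  apply: (wspan_linear _ _ (X \o* idfun)) => w [altw degw] /=.
  apply: (wspan_sub _ _ _ _ (eval_wordMr true _ altw)) => v [altv [?|[_ ?]]]; split=> //; lia.
have MY d a : M d a -> M d (a * Y).
  apply: (wspan_linear _ _ (Y \o* idfun)) => w [altw degw] /=.
  apply: (wspan_sub _ _ _ _ (eval_wordMr false _ altw)) => v [altv [?|[_ ?]]]; split=> //; lia.
have MYX : M n ((Y * X) ^+ n * Y).
  apply: (MY _ _); elim: n {nk} => [|n IH].
    by rewrite expr0 -eval_word_nil; apply: wspan_word; rewrite /degX big_nil.
  by rewrite exprSr mulrA; apply: (MX _ _); exact: MY.
have -> : (X * Y) ^+ n.+2 = X * ((Y * X) ^+ n * Y * X) * Y.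
  elim: {MYX nk} n => [|n IH]; first by rewrite expr0 mul1r expr2 !mulrA.
  by rewrite exprS IH exprS !mulrA.
(* The last factor [X] adds degree only to words that end in [X], so all other words stay at degree
   at most [n], where [1 + n <= k]. *)
have : wspan (fun w => ends_in_X w \/ alternating w /\ (degX w <= n)%N)
    ((Y * X) ^+ n * Y * X).
  move: MYX; apply: (wspan_linear _ _ (X \o* idfun)) => w [altw degw] /=.
  apply: (wspan_sub _ _ _ _ (eval_wordMr true _ altw)) => v [altv [?|[[u [m vE]] _]]].
    by right; split => //; lia.
  by left; rewrite /ends_in_X vE alternating_rcons -vE altv.
elim=> [|c w b Pw _ IH]; first by rewrite mulr0 mul0r linear0.
rewrite mulrDr mulrDl linearD IH addr0 -scalerAr -scalerAl linearZ /=.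
(* Words ending in [X] are killed by [phi Y = 0], words of small degree by the vanishing moments of
   [X]. *)
case: Pw => [Ew|[altw degw]].
  rewrite phi_mulYr ?phiY ?mulr0 //.
  by apply: ends_in_X_mulXl; exact: wspan_word.
rewrite -mulrA -[in phi _](expr1 X) (phi_mulXl k _ n) ?mulr0 //.
by apply: MY; exact: wspan_word.
Qed.

End CenteredWords.

(** * Vanishing moments of convolution powers and of infinitely divisible pairs *)

Section InfinitelyDivisible.
Context {R : realType}.
Local Notation pair := (probability (circle R) R * probability (circle R) R)%type.

Lemma cfree_mconv_moment1 (p1 p2 p : pair) : is_cfree_mconv p1 p2 p ->
  moment p.1 1 = moment p1.1 1 * moment p2.1 1.
Proof.
case=> A [phi [psi [X [Y [[phi1 psi1] cfXY dX dY dXY]]]]].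
have [/esym -> _] := dXY 1 isT; have [/esym -> _] := dX 1 isT.
have [/esym -> _] := dY 1 isT; rewrite !expr1.
apply: (phi_mulYr phi psi X Y phi1 psi1 cfXY).
rewrite -[X in wspan _ _ _ _ X]mulr1; apply: ends_in_X_mulXl => //.
by rewrite -(eval_word_nil psi X Y); apply: wspan_word.
Qed.

Lemma cfree_mpow_moment1 (q p : pair) n : is_cfree_mpow q n p ->
  moment p.1 1 = moment q.1 1 ^+ n.
Proof.
elim=> [|m r s _ IH /cfree_mconv_moment1 ->]; first by rewrite expr1.
by rewrite IH exprSr.
Qed.

(** Each further factor [q], in the role of [Y], makes one more moment vanish. *)
Lemma cfree_mpow_moments (q p : pair) n : is_cfree_mpow q n p ->
  moment q.1 1 = 0 -> forall j, (0 < j <= n)%N -> moment p.1 j = 0.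
Proof.
move=> qnp q0; elim: qnp => [|m r s _ IH].
  by move=> j j1; have -> : j = 1%N by lia.
case=> A [phi [psi [X [Y [[phi1 psi1] cfXY dX dY dXY]]]]] j jm.
have j0 : (0 < j)%N by lia.
have [/esym -> _] := dXY j j0.
apply: (phi_mulXY_moments phi psi X Y phi1 psi1 cfXY m) => //.
  by move=> i im; have [|-> _] := dX i; [lia | exact: IH].
by have [] := dY 1 isT; rewrite expr1 q0.
Qed.

Lemma minfdiv_moments (p : pair) : cfree_minfdiv p -> moment p.1 1 = 0 ->
  forall n, (0 < n)%N -> moment p.1 n = 0.
Proof.
move=> infdiv p0 n n0; have [q qp] := infdiv n n0.
apply: (cfree_mpow_moments _ _ _ qp); last by rewrite n0 leqnn.
(* The mean of [p] is the [n]-th power of the mean of [q], so the latter is 0 as well. *)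
move: p0; rewrite (cfree_mpow_moment1 _ _ _ qp) => /eqP.
by rewrite expf_eq0 => /andP[_ /eqP].
Qed.

End InfinitelyDivisible.

(** * Bounded measurable functions on the circle *)

Section CircleFunctions.
Context {R : realType}.
Implicit Types (f g : circle R -> R) (z : circle R).

Definition circle_re z : R := complex.Re (circle_val z).
Definition circle_im z : R := complex.Im (circle_val z).

Lemma norm_circle_val z : `|circle_val z| = 1.
Proof. by case: z => x xP; exact: set_mem xP. Qed.

Lemma circle_sqr z : circle_re z ^+ 2 + circle_im z ^+ 2 = 1.
Proof.
by apply: (@complexI R); rewrite add_Re2_Im2 norm_circle_val expr1n.
Qed.

Lemma continuous_circle_val :
  continuous (fun z => circle_val z : R[i]^o).
Proof. exact: initial_continuous. Qed.

Lemma continuous_complexRe : continuous (@complex.Re R : R[i]^o -> R).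
Proof.
move=> t A /nbhs_ballP[e e0 eA].
apply/(@nbhs_ballP _ R[i]^o); exists e%:C%C; first by rewrite /= ltcR.
rewrite -ball_normE => s /= ts; apply: eA; rewrite -ball_normE /=.
by rewrite -raddfB -ltcR; exact: le_lt_trans (normc_ge_Re _) ts.
Qed.

Lemma continuous_complexIm : continuous (@complex.Im R : R[i]^o -> R).
Proof.
have normc_ge_Im (x : R[i]) : `|complex.Im x|%:C%C <= `|x|.
  by rewrite normc_def lecR -sqrtr_sqr ler_wsqrtr // lerDr sqr_ge0.
move=> t A /nbhs_ballP[e e0 eA].
apply/(@nbhs_ballP _ R[i]^o); exists e%:C%C; first by rewrite /= ltcR.
rewrite -ball_normE => s /= ts; apply: eA; rewrite -ball_normE /=.
by rewrite -raddfB -ltcR; exact: le_lt_trans (normc_ge_Im _) ts.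
Qed.

Lemma continuous_circle_measurable f : continuous f -> measurable_fun setT f.
Proof.
move=> /continuousP cf; apply: (measurability _ (measurable_realfun.RGenOpens.measurableE R)).
move=> _ [_ [a [b ->]] <-]; rewrite setTI; apply: sub_sigma_algebra.
by apply: cf; exact: interval_open.
Qed.

Definition bounded_mfun f :=
  measurable_fun setT f /\ exists M, forall z, `|f z| <= M.

Lemma bounded_mfun_cst (c : R) : bounded_mfun (cst c).
Proof. by split; [exact: measurable_cst | exists `|c|]. Qed.

Lemma bounded_mfunD f g : bounded_mfun f -> bounded_mfun g -> bounded_mfun (f \+ g).
Proof.
move=> [mf [M fM]] [mg [N gN]]; split; first exact: measurable_realfun.measurable_funD.
by exists (M + N) => z; rewrite (le_trans (ler_normD _ _))// lerD.
Qed.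

Lemma bounded_mfunM f g : bounded_mfun f -> bounded_mfun g -> bounded_mfun (f \* g).
Proof.
move=> [mf [M fM]] [mg [N gN]]; split; first exact: measurable_realfun.measurable_funM.
by exists (M * N) => z; rewrite normrM ler_pM.
Qed.

Lemma bounded_mfun_re : bounded_mfun circle_re.
Proof.
split; last first.
  exists 1 => z; have := circle_sqr z; rewrite -(@expr_le1 _ 2)// => zE.
  by rewrite real_normK ?num_real//; have := sqr_ge0 (circle_im z); lra.
apply: continuous_circle_measurable => z.
by apply: continuous_comp; [exact: continuous_circle_val|exact: continuous_complexRe].
Qed.

Lemma bounded_mfun_im : bounded_mfun circle_im.
Proof.
split; last first.
  exists 1 => z; have := circle_sqr z; rewrite -(@expr_le1 _ 2)// => zE.
  by rewrite real_normK ?num_real//; have := sqr_ge0 (circle_re z); lra.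
apply: continuous_circle_measurable => z.
by apply: continuous_comp; [exact: continuous_circle_val|exact: continuous_complexIm].
Qed.

(** Real and imaginary parts are treated together, because a Horner step mixes them. *)
Lemma bounded_mfun_poly (p : {poly R[i]}) :
  bounded_mfun (fun z => complex.Re p.[circle_val z]) /\
  bounded_mfun (fun z => complex.Im p.[circle_val z]).
Proof.
elim/poly_ind: p => [|p c [IHr IHi]].
  by split; under eq_fun do rewrite horner0; exact: bounded_mfun_cst.
have opp f : bounded_mfun f -> bounded_mfun (cst (-1) \* f).
  by apply: bounded_mfunM; exact: bounded_mfun_cst.
split.
  have -> : (fun z => complex.Re (p * 'X + c%:P).[circle_val z]) =
     ((fun z => complex.Re p.[circle_val z]) \* circle_re) \+
     (cst (-1) \* ((fun z => complex.Im p.[circle_val z]) \* circle_im))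
     \+ cst (complex.Re c).
    apply/funext => z; rewrite hornerMXaddC /= /circle_re /circle_im.
    by case: p.[_] => a b; case: (circle_val z) => x y; case: c => u v /=; ring.
  apply: bounded_mfunD; last exact: bounded_mfun_cst.
  apply: bounded_mfunD.
    by apply: bounded_mfunM => //; exact: bounded_mfun_re.
  by apply: opp; apply: bounded_mfunM => //; exact: bounded_mfun_im.
have -> : (fun z => complex.Im (p * 'X + c%:P).[circle_val z]) =
   ((fun z => complex.Re p.[circle_val z]) \* circle_im) \+
   ((fun z => complex.Im p.[circle_val z]) \* circle_re) \+ cst (complex.Im c).
  apply/funext => z; rewrite hornerMXaddC /= /circle_re /circle_im.
  by case: p.[_] => a b; case: (circle_val z) => x y; case: c => u v /=; ring.
apply: bounded_mfunD; last exact: bounded_mfun_cst.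
  apply: bounded_mfunD.
  by apply: bounded_mfunM => //; exact: bounded_mfun_im.
by apply: bounded_mfunM => //; exact: bounded_mfun_re.
Qed.

Lemma bounded_mfun_circleX n :
  bounded_mfun (fun z => complex.Re (circle_val z ^+ n)) /\
  bounded_mfun (fun z => complex.Im (circle_val z ^+ n)).
Proof.
have [br bi] := bounded_mfun_poly 'X^n.
by split; [move: br|move: bi]; under eq_fun do rewrite hornerXn.
Qed.

Lemma bounded_mfun_integrable (P : probability (circle R) R) f :
  bounded_mfun f -> P.-integrable setT (EFin \o f).
Proof.
move=> [mf [M fM]]; apply: measurable_bounded_integrable => //.
  by apply: (le_lt_trans (probability_le1 P measurableT)); rewrite ltry.
exists M; split; first by rewrite num_real.
by move=> x Mx z _; apply: le_trans (fM z) _; exact: ltW.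
Qed.


(** * Real trigonometric polynomials and their integrals *)

Lemma complex_ReD (u v : R[i]) :
  complex.Re (u + v) = complex.Re u + complex.Re v.
Proof. by case: u; case: v. Qed.

(* As z^-1 is the conjugate of z, these are all the real trigonometric polynomials. *)
Definition trig_poly f :=
  exists p : {poly R[i]}, forall z, f z = complex.Re p.[circle_val z].

Lemma trig_poly_bounded f : trig_poly f -> bounded_mfun f.
Proof. by move=> [p /funext ->]; exact: (bounded_mfun_poly p).1. Qed.

Lemma trig_poly_cst (c : R) : trig_poly (cst c).
Proof. by exists c%:C%C%:P => z; rewrite hornerC. Qed.

Lemma trig_poly_re : trig_poly circle_re.
Proof. by exists 'X => z; rewrite hornerX. Qed.

Lemma trig_poly_im : trig_poly circle_im.
Proof.
exists ((0 -i* 1)%C *: 'X) => z; rewrite hornerZ hornerX /circle_im.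
by case: (circle_val z) => x y /=; ring.
Qed.

Lemma trig_polyD f g : trig_poly f -> trig_poly g -> trig_poly (f \+ g).
Proof.
by move=> [p fp] [q gq]; exists (p + q) => z; rewrite hornerD raddfD /= fp gq.
Qed.

(** [Re u Re v] is half of [Re (u v) + Re (u conj v)], and on the circle the second term is again
    the real part of a polynomial. *)
Lemma trig_polyM f g : trig_poly f -> trig_poly g -> trig_poly (f \* g).
Proof.
move=> [p fp] [q gq].
have [r rE] : exists r : {poly R[i]}, forall z,
    complex.Re (p.[circle_val z] * (q.[circle_val z])^*%C) =
    complex.Re r.[circle_val z].
  elim/poly_ind: p q {f g fp gq} => [|p c IH] q.
    by exists 0 => z; rewrite !horner0 mul0r.
  elim/poly_ind: q => [|q d _].
    by exists 0 => z; rewrite !horner0 rmorph0 mulr0.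
  have [r rE] := IH q.
  (* In [(p z + c) conj (q z + d)] the leading term is [p conj q], as [z conj z = 1]; the term
     [c conj (q z)] has the same real part as [conj c q z]. *)
  exists (r + (c^*%C *: (q * 'X) + (d^*%C *: (p * 'X) + (c * d^*%C)%:P))) => z.
  rewrite !hornerD !hornerZ !hornerM !hornerX !hornerC.
  have zz := circle_sqr z.
  rewrite [RHS]complex_ReD -rE; move: zz; rewrite /circle_re /circle_im; clear.
  case: p.[_] => a b; case: q.[_] => e f; case: (circle_val z) => x y /=.
  case: c => u v; case: d => s t /= zz.
  apply/eqP; rewrite -subr_eq0; apply/eqP.
  transitivity ((x ^+ 2 + y ^+ 2 - 1) * (a * e + b * f)); first by ring.
  by rewrite zz subrr mul0r.
exists (2^-1%:C%C *: (p * q + r)) => z.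
rewrite hornerZ hornerD hornerM /= fp gq.
move: (rE z); case: p.[_] => a b; case: q.[_] => c d; case: r.[_] => u v /= <-.
by field.
Qed.

Lemma trig_polyX f n : trig_poly f -> trig_poly (fun z => f z ^+ n).
Proof.
move=> tf; elim: n => [|n IH]; first exact: (trig_poly_cst 1).
by under eq_fun do rewrite exprS; exact: trig_polyM.
Qed.

(** Moments will be compared in positive order only; this handles constant coefficients. *)
Lemma moment0 (P : probability (circle R) R) : moment P 0 = 1.
Proof.
have cstE c f : (forall z, f z = c) -> \int[P]_z f z = c.
  move=> fc; under eq_Rintegral do rewrite fc.
  rewrite Rintegral_cst// -[RHS]mulr1; congr (c * _).
  exact: (congr1 fine (probability_setT P)).
by rewrite /moment (cstE 1) ?(cstE 0)// => z; rewrite expr0.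
Qed.

Section EqualMoments.
Variables P Q : probability (circle R) R.
Hypothesis momPQ : forall n, (0 < n)%N -> moment P n = moment Q n.

(** By linearity it suffices to treat monomials, where [Re ((a + ib) z^i)] integrates to a
    combination of the two parts of the [i]-th moment. *)
Lemma trig_poly_integral f : trig_poly f ->
  (\int[P]_z (f z)%:E = \int[Q]_z (f z)%:E)%E.
Proof.
move=> tf.
have bf := trig_poly_bounded f tf; move: tf => [p /funext fE].
rewrite -(fineK (integrable_fin_num _ (bounded_mfun_integrable P _ bf)))//.
rewrite -(fineK (integrable_fin_num _ (bounded_mfun_integrable Q _ bf)))//.
congr _%:E; rewrite -!/(Rintegral _ _ _) {}fE {f bf}.
have int (P' : probability (circle R) R) q : P'.-integrable setT
    (EFin \o (fun z => complex.Re q.[circle_val z])).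
  exact: bounded_mfun_integrable (bounded_mfun_poly q).1.
pose E := fun q : {poly R[i]} => \int[P]_z complex.Re q.[circle_val z] =
  \int[Q]_z complex.Re q.[circle_val z].
rewrite -[p]coefK poly_def -/(E _); apply: (big_ind E).
- by rewrite /E; under eq_Rintegral do rewrite horner0;
    under [RHS]eq_Rintegral do rewrite horner0; rewrite !Rintegral_cst// !mul0r.
- move=> q r Eq Er; rewrite /E.
  under eq_Rintegral do rewrite hornerD complex_ReD.
  under [RHS]eq_Rintegral do rewrite hornerD complex_ReD.
  rewrite !RintegralD//; [|exact: int..].
  by congr (_ + _); [exact: Eq|exact: Er].
move=> i _; rewrite /E; case: p`_i => a b.
have monE (P' : probability (circle R) R) :
    \int[P']_z complex.Re ((a +i* b)%C *: 'X^i).[circle_val z] =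
    a * complex.Re (moment P' i) - b * complex.Im (moment P' i).
  have [br bi] := bounded_mfun_circleX i.
  have intZ c f : bounded_mfun f -> P'.-integrable setT (EFin \o (fun z => c * f z)).
    move=> bf; apply: bounded_mfun_integrable.
    exact: (bounded_mfunM _ _ (bounded_mfun_cst c) bf).
  rewrite /moment /= -!RintegralZl//; try exact: bounded_mfun_integrable.
  rewrite -RintegralB//; [|exact: intZ..].
  apply: eq_Rintegral => z _; rewrite hornerZ hornerXn.
  by case: (_ ^+ _).
rewrite !monE; case: (posnP i) => [->|/momPQ ->//].
by rewrite !moment0.
Qed.

End EqualMoments.

(** * Indicators as bounded pointwise limits of trigonometric polynomials *)

Lemma bernoulli_le (x : R) n : -1 <= x -> 1 + n%:R * x <= (1 + x) ^+ n.
Proof.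
move=> x1; elim: n => [|n IH]; first by rewrite mul0r addr0 expr0.
rewrite exprSr; apply: le_trans (_ : (1 + n%:R * x) * (1 + x) <= _); last first.
  by apply: ler_wpM2r => //; lra.
rewrite -natr1; have : 0 <= n%:R * x ^+ 2 by rewrite mulr_ge0// sqr_ge0.
by lra.
Qed.

(* [n * 2 ^ n * y ^ n] tends to 0 if [y < 1/2] and to infinity if [y >= 1/2], so on
   [0, 1] these polynomials converge pointwise to the indicator of [0, 1/2). *)
Definition step_poly n (y : R) := (1 - y ^+ n) ^+ (n * 2 ^ n).

Lemma step_poly_itv n y : 0 <= y <= 1 -> 0 <= step_poly n y <= 1.
Proof.
move=> /andP[y0 y1].
have : 0 <= y ^+ n <= 1 by rewrite exprn_ge0//= exprn_ile1.
by move=> yn; rewrite /step_poly exprn_ge0 ?exprn_ile1//; lra.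
Qed.

(** Put [t = y^n] and [N = n 2^n]. Then [(1 - t)^N (1 + t)^N <= 1], while Bernoulli gives
    [(1 + t)^N >= 1 + n (2 y)^n >= n + 1]. *)
Lemma step_poly_cvg0 y : 2^-1 <= y <= 1 -> step_poly n y @[n --> \oo] --> (0 : R).
Proof.
move=> /andP[y2 y1]; have y0 : 0 <= y by apply: le_trans y2.
apply: (@squeeze_cvgr _ _ _ _ (cst 0) (fun n => n.+1%:R^-1)); last 2 first.
- exact: cvg_cst.
- exact: cvg_harmonic.
apply: nearW => n; have /andP[q0 q1] := step_poly_itv n y ltac:(by rewrite y0).
rewrite q0 /= -[leRHS]mul1r ler_pdivlMr ?ltr0n//.
have /andP[yn0 yn1] : 0 <= y ^+ n <= 1 by rewrite exprn_ge0//= exprn_ile1.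
apply: le_trans (_ : step_poly n y * (1 + y ^+ n) ^+ (n * 2 ^ n) <= _).
  apply: ler_wpM2l => //; apply: le_trans (bernoulli_le (y ^+ n) (n * 2 ^ n) _).
    rewrite -natr1 addrC lerD2l natrM -mulrA ler_peMr//.
    by rewrite natrX -exprMn exprn_ege1//; lra.
  by lra.
rewrite /step_poly -exprMn exprn_ile1//; have := sqr_ge0 (y ^+ n); nra.
Qed.

(** With [s] the square root of [r], the bound [n s^n (1 - s) <= 1] yields
    [n r^n <= s^n / (1 - s)]. *)
Lemma cvg_natmul_expr (r : R) : 0 <= r < 1 -> n%:R * r ^+ n @[n --> \oo] --> (0 : R).
Proof.
move=> /andP[r0 r1]; pose s := Num.sqrt r.
have s0 : 0 <= s by exact: sqrtr_ge0.
have s1 : s < 1 by rewrite -sqrtr1 ltr_sqrt.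
have ns n : n%:R * s ^+ n * (1 - s) <= 1.
  apply: le_trans (_ : 1 - s ^+ n <= _); last by rewrite gerBl exprn_ge0.
  elim: n => [|n IH]; first by rewrite mul0r mul0r expr0 subrr.
  have st1 : s * s ^+ n <= 1 by rewrite -exprS exprn_ile1// ltW.
  have : 0 <= (1 - s) * (1 - s * s ^+ n) by apply: mulr_ge0; lra.
  have : s * (n%:R * s ^+ n * (1 - s)) <= s * (1 - s ^+ n) by exact: ler_wpM2l.
  by rewrite -natr1 exprS; lra.
apply: (@squeeze_cvgr _ _ _ _ (cst 0) (fun n => s ^+ n * (1 - s)^-1)).
- apply: nearW => n; rewrite mulr_ge0 ?exprn_ge0//=.
  rewrite ler_pdivlMr ?subr_gt0// -[in leLHS](sqr_sqrtr r0) -/s exprAC expr2.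
  by have := ns n; have := exprn_ge0 n s0; nra.
- exact: cvg_cst.
- rewrite -[X in _ --> X](mul0r (1 - s)^-1); apply: cvgM; last exact: cvg_cst.
  by apply: cvg_expr; rewrite ger0_norm.
Qed.

(** Bernoulli bounds the polynomial below by [1 - n (2 y)^n], where [2 y < 1]. *)
Lemma step_poly_cvg1 y : 0 <= y < 2^-1 -> step_poly n y @[n --> \oo] --> (1 : R).
Proof.
move=> /andP[y0 y2].
apply: (@squeeze_cvgr _ _ _ _ (fun n => 1 - n%:R * (2 * y) ^+ n) (cst 1)).
- apply: nearW => n.
  have /andP[_ ->] := step_poly_itv n y ltac:(apply/andP; split; lra).
  rewrite andbT exprMn mulrA -natrX -natrM -mulrN; apply: bernoulli_le.
  by rewrite lerN2 exprn_ile1//; lra.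
- rewrite -[X in _ --> X]subr0; apply: cvgB; first exact: cvg_cst.
  by apply: cvg_natmul_expr; lra.
- exact: cvg_cst.
Qed.

(** The bounds 0 and 1 pass to products and later allow dominated convergence. *)
Definition trig_limit (A : set (circle R)) :=
  exists g : nat -> circle R -> R, [/\ forall n, trig_poly (g n),
    forall n z, 0 <= g n z <= 1 & forall z, g n z @[n --> \oo] --> (\1_A z : R)].

Lemma trig_limitI A B : trig_limit A -> trig_limit B -> trig_limit (A `&` B).
Proof.
move=> [f [tf f01 fA]] [g [tg g01 gB]]; exists (fun n => f n \* g n); split.
- by move=> n; exact: trig_polyM.
- move=> n z; have /andP[f0 f1] := f01 n z; have /andP[g0 g1] := g01 n z.
  by rewrite mulr_ge0//= mulr_ile1.
- by move=> z; rewrite indicI; exact: cvgM.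
Qed.

Lemma trig_limit_pos f : trig_poly f -> trig_limit [set z | 0 < f z].
Proof.
move=> tf; have [_ [M fM]] := trig_poly_bounded f tf.
pose K := `|M| + 1.
have K0 : 0 < K by rewrite ltr_wpDl.
have fK z : `|f z| <= K.
  by apply: le_trans (fM z) _; rewrite (le_trans (ler_norm _))// lerDl.
(* This rescaling maps into [0, 1], and [f z > 0] exactly when [y z < 1/2], the threshold of
   [step_poly]. *)
pose y z := 2^-1 + (- (2 * K)^-1) * f z.
have y01 z : 0 <= y z <= 1.
  have := fK z; rewrite ler_norml => /andP[fl fu].
  have E : (2 * K)^-1 * K = 2^-1 by field; rewrite gt_eqF.
  have K2 : 0 < (2 * K)^-1 by rewrite invr_gt0 mulr_gt0.
  by rewrite /y; apply/andP; split; nra.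
have ty : trig_poly y.
  apply: trig_polyD; first exact: trig_poly_cst.
  exact: (trig_polyM _ _ (trig_poly_cst _) tf).
exists (fun n z => step_poly n (y z)); split.
- move=> n; apply: (trig_polyX (fun z => 1 - y z ^+ n)).
  have -> : (fun z => 1 - y z ^+ n) = cst 1 \+ (cst (-1) \* (fun z => y z ^+ n)).
    by apply/funext => z /=; rewrite mulN1r.
  apply: trig_polyD; first exact: trig_poly_cst.
  by apply: trig_polyM; [exact: trig_poly_cst|exact: trig_polyX].
- by move=> n z; exact: step_poly_itv.
- move=> z; have /andP[y0 y1] := y01 z.
  have K2 : 0 < (2 * K)^-1 by rewrite invr_gt0 mulr_gt0.
  rewrite indicE; case: (boolP (z \in _)) => [|/negP]; rewrite inE /= => fz.
    by apply: step_poly_cvg1; rewrite y0 /y; nra.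
  move/negP in fz; rewrite -leNgt in fz.
  by apply: step_poly_cvg0; rewrite y1 andbT /y; nra.
Qed.

(** * Rectangles generate the Borel sets, and moments determine the measure *)

Definition rect (a b c d : R) : set (circle R) :=
  [set z | a < circle_re z < b /\ c < circle_im z < d].

Lemma trig_limit_rect a b c d : trig_limit (rect a b c d).
Proof.
have -> : rect a b c d = [set z | 0 < (circle_re \+ cst (- a)) z]
   `&` [set z | 0 < (cst b \+ (cst (-1) \* circle_re)) z]
   `&` ([set z | 0 < (circle_im \+ cst (- c)) z]
   `&` [set z | 0 < (cst d \+ (cst (-1) \* circle_im)) z]).
  apply/seteqP; split => z; rewrite /rect /= !mulN1r !subr_gt0.
    by move=> [/andP[-> ->] /andP[-> ->]].
  by move=> [[-> ->] [-> ->]].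
have tN f : trig_poly f -> trig_poly (cst (-1) \* f).
  by apply: trig_polyM; exact: trig_poly_cst.
do 2! apply: trig_limitI; apply: trig_limit_pos.
all: apply: trig_polyD; try exact: trig_poly_cst.
- exact: trig_poly_re.
- exact: (tN _ trig_poly_re).
- exact: trig_poly_im.
- exact: (tN _ trig_poly_im).
Qed.

Lemma measurable_rect a b c d : measurable (rect a b c d).
Proof.
have -> : rect a b c d = circle_re @^-1` `]a, b[ `&` circle_im @^-1` `]c, d[.
  by apply/seteqP; split => z; rewrite /rect /= !in_itv.
apply: measurableI; rewrite -[X in measurable X]setTI.
  exact: bounded_mfun_re.1.
exact: bounded_mfun_im.1.
Qed.

Lemma open_circle_rect (U : set (circle R)) z : open U -> U z ->
  exists a b c d : rat, rect (ratr a) (ratr b) (ratr c) (ratr d) z /\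
    rect (ratr a) (ratr b) (ratr c) (ratr d) `<=` U.
Proof.
move=> [V oV <-] Vz.
have /(@nbhs_ballP _ R[i]^o)[e /= e0 eV] : nbhs (circle_val z : R[i]^o) V.
  by move: oV; rewrite openE => /(_ _ Vz).
(* The radius is a complex number; being positive, it is real. *)
have [e1 eE] : 0 < complex.Re e /\ e = (complex.Re e)%:C%C.
  by case: e e0 {eV} => a b; rewrite ltcE /= => /andP[/eqP -> ->].
(* Each coordinate will differ by at most [r], so the distance is at most [2 r], half the radius. *)
pose r := complex.Re e / 4; have r0 : 0 < r by rewrite divr_gt0.
have /rat_in_itvoo[a] : circle_re z - r < circle_re z by lra.
rewrite in_itv /= => /andP[a1 a2].
have /rat_in_itvoo[b] : circle_re z < circle_re z + r by lra.
rewrite in_itv /= => /andP[b1 b2].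
have /rat_in_itvoo[c] : circle_im z - r < circle_im z by lra.
rewrite in_itv /= => /andP[c1 c2].
have /rat_in_itvoo[d] : circle_im z < circle_im z + r by lra.
rewrite in_itv /= => /andP[d1 d2].
exists a, b, c, d; split; first by rewrite /rect /= a2 b1 c2 d1.
move=> w [/andP[aw bw] /andP[cw dw]]; apply: eV; rewrite -ball_normE /= eE.
have -> : circle_val z - circle_val w =
    ((circle_re z - circle_re w) +i* (circle_im z - circle_im w))%C :> R[i].
  by rewrite /circle_re /circle_im; case: (circle_val z); case: (circle_val w).
apply: le_lt_trans (normc_le _ _) _; rewrite ltcR.
apply: (@le_lt_trans _ _ (r + r)); last by rewrite /r; lra.
have : `|circle_re z - circle_re w| <= r by rewrite ler_norml; lra.
have : `|circle_im z - circle_im w| <= r by rewrite ler_norml; lra.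
by lra.
Qed.

Definition rects := [set A : set (circle R) | exists a b c d, A = rect a b c d].

Lemma rects_generate : measurable = <<s rects >> :> set (set (circle R)).
Proof.
apply/seteqP; split; last first.
  apply: smallest_sub; first exact: sigma_algebra_measurable.
  by move=> _ [a [b [c [d ->]]]]; exact: measurable_rect.
apply: smallest_sub; first exact: smallest_sigma_algebra.
move=> U oU.
pose F (q : rat * rat * rat * rat) : set (circle R) :=
  rect (ratr q.1.1.1) (ratr q.1.1.2) (ratr q.1.2) (ratr q.2).
(* Rational corners make the rectangles inside [U] enumerable; codes of no such rectangle give the
   empty set. *)
pose G n := if unpickle n is Some q then if `[< F q `<=` U >] then F q else set0
  else set0.
have -> : U = \bigcup_n G n.
  apply/seteqP; split => [z Uz|z [n _]]; last first.
    by rewrite /G; case: unpickle => // q; case: asboolP => // FU /FU.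
  have [a [b [c [d [zr rU]]]]] := open_circle_rect U z oU Uz.
  exists (pickle (a, b, c, d)); first exact: I.
  by rewrite /G pickleK asboolT.
apply: sigma_algebra_bigcup => n; rewrite /G.
case: unpickle => [q|]; last exact: sigma_algebra0.
case: ifP => _; last exact: sigma_algebra0.
by apply: sub_sigma_algebra; do 4 eexists.
Qed.

Lemma rects_setI_closed : setI_closed rects.
Proof.
move=> _ _ [a [b [c [d ->]]]] [a' [b' [c' [d' ->]]]].
exists (Num.max a a'), (Num.min b b'), (Num.max c c'), (Num.min d d').
apply/seteqP; split => z; rewrite /rect /= !gt_max !lt_min.
  by move=> [[/andP[-> ->] /andP[-> ->]] [/andP[-> ->] /andP[-> ->]]].
by move=> [/andP[/andP[-> ->] /andP[-> ->]] /andP[/andP[-> ->] /andP[-> ->]]].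
Qed.

Lemma trig_limit_measure (P : probability (circle R) R) A
    (g : nat -> circle R -> R) : measurable A ->
  (forall n, trig_poly (g n)) -> (forall n z, 0 <= g n z <= 1) ->
  (forall z, g n z @[n --> \oo] --> (\1_A z : R)) ->
  (\int[P]_z (g n z)%:E @[n --> \oo] --> P A)%E.
Proof.
move=> mA tg g01 gA; rewrite -(setIT A) -(integral_indic P measurableT mA).
apply: (dominated_cvg measurableT (g := EFin \o cst 1)).
- move=> n; apply/measurable_realfun.measurable_EFinP.
  exact: (trig_poly_bounded _ (tg n)).1.
- by move=> z _; apply: cvg_EFin; [exact: nearW | exact: gA].
- by [].
- exact: bounded_mfun_integrable (bounded_mfun_cst 1).
- move=> n z _; rewrite lee_fin; have /andP[g0 g1] := g01 n z.
  by rewrite ger0_norm.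
Qed.

Lemma moment_inj (P Q : probability (circle R) R) :
  (forall n, (0 < n)%N -> moment P n = moment Q n) ->
  forall A, measurable A -> P A = Q A.
Proof.
(* Uniqueness on a generating family stable under intersection; the exhausting sequence is constant,
   as this rectangle contains the circle. *)
move=> momPQ; apply: (measure_unique rects (fun=> rect (-2) 2 (-2) 2)).
- exact: rects_generate.
- exact: rects_setI_closed.
- by move=> _; do 4 eexists.
- apply/seteqP; split => // z _; exists 0%N => //; rewrite /rect /=.
  by have := circle_sqr z; nra.
- move=> _ [a [b [c [d ->]]]].
  have [g [tg g01 gA]] := trig_limit_rect a b c d.
  have mA := measurable_rect a b c d.
  have cP := trig_limit_measure P _ g mA tg g01 gA.
  have cQ := trig_limit_measure Q _ g mA tg g01 gA.
  have PQ : (fun n => (\int[P]_z (g n z)%:E)%E) = (fun n => (\int[Q]_z (g n z)%:E)%E).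
    by apply/funext => n; apply: trig_poly_integral.
  have limP := cvg_lim (@ereal_hausdorff R) cP.
  have limQ := cvg_lim (@ereal_hausdorff R) cQ.
  rewrite PQ in limP; exact: etrans (esym (limP _)) (limQ _).
- by move=> _; apply: (le_lt_trans (probability_le1 P (measurable_rect _ _ _ _)));
    rewrite ltry.
Qed.

(** * Moments of the Haar measure *)

(** Pushing forward along [expi] gives an average over [0, 2 pi], evaluated by the fundamental
    theorem of calculus. Nonnegativity serves the change of variables. *)
Lemma haar_integral f (F : R -> R) : bounded_mfun f -> (forall z, 0 <= f z) ->
  continuous (f \o @expi R : R -> R) ->
  (forall t : R, is_derive t 1 F (f (expi t))) ->
  (\int[haar R]_z (f z)%:E = ((2 * pi)^-1 * (F (2 * pi)%R - F 0))%:E)%E.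
Proof.
move=> bf f0 cf dF.
have /measurable_realfun.measurable_EFinP mf := bf.1.
have /measurable_realfun.measurable_EFinP mfe :=
  measurable_realfun.continuous_measurable_fun cf.
have cF (t : R) : {for t, continuous F}.
  by apply/differentiable_continuous/derivable1_diffP; exact: ex_derive.
have -> : (\int[haar R]_z (f z)%:E =
    \int[uniform_prob (two_pi_gt0 R)]_t ((EFin \o f) \o @expi R) t)%E.
  apply: ge0_integral_pushforward => //.
  by move=> z _; rewrite lee_fin.
apply: etrans (integral_uniform (two_pi_gt0 R) mfe _) _.
  by move=> t /=; rewrite lee_fin; exact: f0.
rewrite subr0 (continuous_FTC2 (F := F) (f := f \o @expi R)) ?two_pi_gt0//.
- exact: continuous_subspaceT.
- split.
  + by move=> t _; exact: ex_derive.
  + exact/cvg_at_right_filter/cF.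
  + exact/cvg_at_left_filter/cF.
- by move=> t _; rewrite derive1E derive_val.
Qed.

Lemma expiX (t : R) n :
  circle_val (expi t) ^+ n = (cos (n%:R * t) +i* sin (n%:R * t))%C.
Proof.
elim: n => [|n IH]; first by rewrite expr0 mul0r cos0 sin0.
rewrite exprSr IH -natr1 mulrDl mul1r cosD sinD /circle_val /=.
by apply/eqP; rewrite eq_complex /=; apply/andP; split; apply/eqP; ring.
Qed.

Lemma haar_moment n : (0 < n)%N -> moment (haar R) n = 0.
Proof.
move=> n0; have n0' : n%:R != 0 :> R by rewrite pnatr_eq0 -lt0n.
have pi0 : pi != 0 :> R by rewrite gt_eqF// pi_gt0.
have period (h : R -> R) : periodic (U := R) (V := R) h (pi *+ 2) ->
    h (n%:R * (2 * pi)) = h 0.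
  move=> /periodicn /(_ n 0) <-; congr h.
  by rewrite add0r -mulrnA -[RHS]mulr_natl natrM; ring.
have [br bi] := bounded_mfun_circleX n.
have zn z : `|complex.Re (circle_val z ^+ n)| <= 1 /\
    `|complex.Im (circle_val z ^+ n)| <= 1.
  have /(congr1 (@complex.Re R)) : `|circle_val z ^+ n| ^+ 2 = 1.
    by rewrite normrX norm_circle_val !expr1n.
  rewrite -add_Re2_Im2 /= => E.
  by split; rewrite -(@expr_le1 _ 2)// real_normK ?num_real//; nra.
(* Adding 1 makes [f] nonnegative; its antiderivative becomes [id + F], so [F (2 pi) = F 0] gives
   [1 + f] the integral 1. *)
have main f (F : R -> R) : bounded_mfun f -> (forall z, `|f z| <= 1) ->
    continuous (f \o @expi R : R -> R) ->
    (forall t : R, is_derive t 1 F (f (expi t))) -> F (2 * pi) = F 0 ->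
    \int[haar R]_z f z = 0.
  move=> bf f1 cf dF FE.
  have b1f : bounded_mfun (cst 1 \+ f).
    by apply: bounded_mfunD => //; exact: bounded_mfun_cst.
  have : \int[haar R]_z (1 + f z) = 1.
    rewrite /Rintegral (haar_integral (cst 1 \+ f) (id \+ F)) //=.
    - by rewrite FE add0r addrK mulVf ?mulf_neq0.
    - by move=> z; have := f1 z; rewrite ler_norml; lra.
    - by move=> t; apply: cvgD; [exact: cvg_cst|exact: cf].
  rewrite RintegralD//; last 2 first.
  - exact: (bounded_mfun_integrable (haar R) _ (bounded_mfun_cst 1)).
  - exact: bounded_mfun_integrable.
  have -> : \int[haar R]_x 1 = 1.
    rewrite Rintegral_cst// mul1r; exact: (congr1 fine (probability_setT _)).
  by lra.
have cn (t : R) : is_derive t 1 (fun t : R => n%:R * t) n%:R.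
  by apply: is_derive_eq; rewrite /GRing.scale /= mulr1.
rewrite /moment; congr (_ +i* _)%C.
- apply: (main _ (fun t => n%:R^-1 * sin (n%:R * t))) => //.
  + by move=> z; exact: (zn z).1.
  + move=> t; have -> : (fun z => complex.Re (circle_val z ^+ n)) \o @expi R =
      cos \o (fun t => n%:R * t) by apply/funext => s /=; rewrite expiX.
    apply: continuous_comp; last exact: continuous_cos.
    exact: mulrl_continuous.
  + move=> t; rewrite expiX /=; apply: is_derive_eq.
    by rewrite /GRing.scale /=; field.
  + by rewrite (period _ (@sinD2pi R)) mulr0.
- apply: (main _ (fun t => - n%:R^-1 * cos (n%:R * t))) => //.
  + by move=> z; exact: (zn z).2.
  + move=> t; have -> : (fun z => complex.Im (circle_val z ^+ n)) \o @expi R =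
      sin \o (fun t => n%:R * t) by apply/funext => s /=; rewrite expiX.
    apply: continuous_comp; last exact: continuous_sin.
    exact: mulrl_continuous.
  + move=> t; rewrite expiX /=; apply: is_derive_eq.
    by rewrite /GRing.scale /=; field.
  + by rewrite (period _ (@cosD2pi R)) mulr0.
Qed.

End CircleFunctions.

Theorem proposition6p2 (R : realType) (mu nu : probability (circle R) R)
  (infdiv_munu : cfree_minfdiv (mu, nu))
  (mean_mu : moment mu 1 = 0) :
  forall B : set (circle R), measurable B -> mu B = haar R B.
Proof.
apply: moment_inj => n n0.
(* Both measures have vanishing moments in every positive order. *)
by rewrite haar_moment// (minfdiv_moments (mu, nu) infdiv_munu mean_mu n n0).
Qed.
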